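(* Let $\mathcal{B}$ be a Banach algebra and let $\mathcal{A}$ be an inverse-closed Banach subalgebra of $\mathcal{B}$. If $A, B, Q \in \mathcal{A}$ and the spectra $\sigma_{\mathcal{B}}(A)$ and $\sigma_{\mathcal{B}}(B)$ of $A$ and $B$ in $\mathcal{B}$ are disjoint, then there is a unique $X\in\mathcal{A}$ satisfying the operator Sylvester equation $BX-XA=Q$.
   Context: Banach algebras are over $\mathbb{C}$ and unital. A Banach subalgebra $\mathcal{A}$ of $\mathcal{B}$ is a subalgebra that is itself a Banach algebra under its own norm $\|\cdot\|_{\mathcal{A}}$ (which may differ from the norm $\|\cdot\|_{\mathcal{B}}$ of $\mathcal{B}$). A subalgebra $\mathcal{A}$ of $\mathcal{B}$ sharing the same identity $I$ with $\mathcal{B}$ is inverse-closed in $\mathcal{B}$ if every element of $\mathcal{A}$ that is invertible in $\mathcal{B}$ is also invertible in $\mathcal{A}$. The spectrum of $A$ in $\mathcal{B}$ is $\sigma_{\mathcal{B}}(A)=\{z\in\mathbb{C}: zI-A \text{ is not invertible in } \mathcal{B}\}$. *)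

(* Defs.v *)
From HB Require Import structures.
From mathcomp Require Import all_boot all_order all_algebra.
From mathcomp Require Import all_classical all_reals all_analysis.
From mathcomp Require Import complex.

Set Implicit Arguments.
Unset Strict Implicit.
Unset Printing Implicit Defensive.

Import Order.TTheory GRing.Theory Num.Theory.
Import numFieldNormedType.Exports.

Local Open Scope classical_set_scope.
Local Open Scope ring_scope.

(* A structure extending both GRing.Algebra and CompleteNormedModule cannot be
   declared directly: the hierarchy makes Num.NumDomain the join of PzSemiRing
   and SemiNormedZmodule.  The ring axioms are therefore stated on top of
   CompleteNormedModule, and the algType instance is declared afterwards.
   The norm of the unit is not required to be 1. *)
HB.mixin Record CompleteNormedModule_isBanachAlgebra (K : numFieldType) V
    & CompleteNormedModule K V := {
  banach_one : V;
  banach_mul : V -> V -> V;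
  banach_mulA : associative banach_mul;
  banach_mul1l : left_id banach_one banach_mul;
  banach_mul1r : right_id banach_one banach_mul;
  banach_mulDl : left_distributive banach_mul +%R;
  banach_mulDr : right_distributive banach_mul +%R;
  banach_one_neq0 : banach_one != 0;
  banach_scaleAl : forall (k : K) (x y : V),
    k *: banach_mul x y = banach_mul (k *: x) y;
  banach_scaleAr : forall (k : K) (x y : V),
    k *: banach_mul x y = banach_mul x (k *: y);
  banach_normM : forall x y : V, `|banach_mul x y| <= `|x| * `|y|
}.

#[short(type="banachAlgType")]
HB.structure Definition BanachAlgebra (K : numFieldType) :=
  {V of CompleteNormedModule K V & CompleteNormedModule_isBanachAlgebra K V}.

HB.instance Definition _ (K : numFieldType) (B : banachAlgType K) :=
  GRing.Zmodule_isNzRing.Build (B : Type) banach_mulA banach_mul1l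
    banach_mul1r banach_mulDl banach_mulDr banach_one_neq0.
HB.instance Definition _ (K : numFieldType) (B : banachAlgType K) :=
  GRing.Lmodule_isLalgebra.Build K (B : Type) banach_scaleAl.
HB.instance Definition _ (K : numFieldType) (B : banachAlgType K) :=
  GRing.Lalgebra_isAlgebra.Build K (B : Type) banach_scaleAr.

(* SubLmodule says that A is the set S with the linear structure of B, \val
   being the inclusion; the mixin adds the same for the unit and the product.
   The norm of A is independent of that of B, and \val is not assumed to be
   continuous. *)
HB.mixin Record isSubBanachAlgebra (K : numFieldType) (B : banachAlgType K)
    (S : pred B) A & @GRing.SubLmodule K B S A & BanachAlgebra K A := {
  sub_banach_val1 : \val (banach_one : A) = banach_one :> B;
  sub_banach_valM : forall x y : A,
    \val (banach_mul x y) = banach_mul (\val x) (\val y) :> B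
}.

#[short(type="subBanachAlgType")]
HB.structure Definition SubBanachAlgebra (K : numFieldType)
    (B : banachAlgType K) (S : pred B) :=
  {A of @GRing.SubLmodule K B S A & BanachAlgebra K A
      & isSubBanachAlgebra K B S A}.

HB.instance Definition _ (K : numFieldType) (B : banachAlgType K)
    (S : pred B) (A : subBanachAlgType S) :=
  GRing.Algebra.copy (A : Type) (BanachAlgebra.sort A).

Fact sub_banach_val_monoid_morphism (K : numFieldType) (B : banachAlgType K)
    (S : pred B) (A : subBanachAlgType S) :
  monoid_morphism (\val : A -> B).
Proof. exact: (conj sub_banach_val1 sub_banach_valM). Qed.

HB.instance Definition _ (K : numFieldType) (B : banachAlgType K)
    (S : pred B) (A : subBanachAlgType S) :=
  GRing.isSubPzSemiRing.Build B S (A : Type) (sub_banach_val_monoid_morphism A).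

Definition invertible (B : pzRingType) (x : B) : Prop :=
  exists y : B, x * y = 1 /\ y * x = 1.

Definition inverse_closed (K : numFieldType) (B : banachAlgType K)
    (S : pred B) (A : subBanachAlgType S) : Prop :=
  forall a : A, invertible (\val a : B) -> invertible a.

Definition spectrum (K : numFieldType) (B : banachAlgType K) (a : B) : set K :=
  [set z | ~ invertible (z%:A - a)].

(* Main.v *)
Require Import Defs.
From HB Require Import structures.
From mathcomp Require Import all_boot all_order all_algebra.
From mathcomp Require Import all_classical all_reals all_analysis.
From mathcomp Require Import complex ring lra.

(* Let T X = B X - X A on the algebra AA, and let M be the algebra of bounded
   linear operators on AA that commute with X |-> B X and X |-> X A.  Modulo the
   ideal T M these two operators coincide; as the spectra are disjoint, for
   every complex l one of l - B, l - A is invertible in AA, so this common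
   operator has a resolvent for every l.  Liouville's theorem, applied in the
   quotient seminorm on M / T M, shows that this seminorm vanishes.  In
   particular ||1 - T D|| < 1 for some D in M; by the contraction principle T D
   is bijective, hence so is T, because T D = D T.

   Liouville's theorem is obtained from a discrete mean value inequality: the
   average of the resolvents at l + h, l - h, l + i h, l - i h differs from the
   resolvent at l by O(h^4), so the seminorm of the resolvent plus
   eps |l|^2 has no interior maximum. *)

Set Implicit Arguments.
Unset Strict Implicit.
Unset Printing Implicit Defensive.

Import Order.TTheory.
Import GRing.Theory Num.Theory numFieldNormedType.Exports.
Local Open Scope classical_set_scope.
Local Open Scope ring_scope.

(** * Equalities in abelian groups *)

Ltac zmod_bring t := lazymatch goal with
  | |- _ = _ + t => idtac
  | |- _ => first [ rewrite [in RHS](addrAC _ t _)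
                  | rewrite [in RHS](addrC t _) ];
            zmod_bring t
  end.

Ltac zmod_cancel := lazymatch goal with
  | |- _ = _ - ?x => zmod_bring x; rewrite ?subrK ?addNr; zmod_cancel
  | |- _ = _ + ?x => zmod_bring (- x); rewrite ?addrK ?subrr; zmod_cancel
  | |- _ => reflexivity
  end.

(* Decides equalities of abelian groups between sums of signed atoms by moving
   everything to one side and cancelling opposite terms. *)
Ltac zmod := apply/esym/eqP; rewrite -subr_eq0; apply/eqP/esym;
  rewrite ?(opprD, opprK) ?addrA; zmod_cancel.

(** * Estimates on the complex modulus *)

Lemma normc_ge0 (R : rcfType) (z : R[i]) : 0 <= Normc.normc z.
Proof. by case: z => x y; exact: sqrtr_ge0. Qed.

Lemma normcX (R : rcfType) (z : R[i]) n :
  Normc.normc (z ^+ n) = Normc.normc z ^+ n.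
Proof.
by elim: n => [|n IH]; rewrite ?expr0 ?Normc.normc1 // !exprS Normc.normcM IH.
Qed.

Lemma normr_le_normc (R : rcfType) (u v : R) :
  Num.max `|u| `|v| <= Normc.normc (u +i* v)%C.
Proof.
by rewrite ge_max -!sqrtr_sqr /= !ler_wsqrtr // (lerDl, lerDr) sqr_ge0.
Qed.

Lemma normc_le_normr (R : rcfType) (u v : R) :
  Normc.normc (u +i* v)%C <= `|u| + `|v|.
Proof.
have uv0 : 0 <= `|u| + `|v| by rewrite addr_ge0.
rewrite -(ger0_norm uv0) -(sqrtr_sqr (_ + _)) /= ler_wsqrtr //.
rewrite sqrrD !real_normK ?num_real // -addrA lerD2l lerDr.
by rewrite mulrn_wge0 // mulr_ge0.
Qed.

Lemma gt0_realc (R : rcfType) (e : R[i]) : 0 < e ->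
  exists2 e' : R, 0 < e' & e = (e'%:C)%C.
Proof.
case: e => e1 e2; rewrite ltcE /= => /andP[/eqP -> e0].
by exists e1.
Qed.

Lemma ge0_realc (R : rcfType) (e : R[i]) : 0 <= e ->
  exists2 e' : R, 0 <= e' & e = (e'%:C)%C.
Proof.
case: e => e1 e2; rewrite lecE /= => /andP[/eqP -> e0].
by exists e1.
Qed.

(** * A discrete Liouville principle on the plane *)

(** If [f (0, 0)] were positive, adding a small multiple [eps] of the squared distance to the origin
    would keep the maximum over a large square in its interior. There the quadratic term forces the
    sum over the four neighbours at distance [h] to drop by [4 * eps * h ^+ 2], which the error of
    order [h ^+ 4] cannot compensate for small [h]. *)
Lemma liouville_discrete (R : realType) (f : R * R -> R) :
  continuous f ->
  (forall e : R, 0 < e -> exists rho : R, forall x y,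
     rho <= `|x| \/ rho <= `|y| -> f (x, y) < e) ->
  (forall x y, exists2 K : R, 0 <= K & forall h : R,
     4 * f (x, y) <= (1 + K * h ^+ 4) *
       (f (x + h, y) + f (x - h, y) + f (x, y + h) + f (x, y - h))) ->
  f (0, 0) <= 0.
Proof.
move=> fcont finf fmean; rewrite leNgt; apply/negP => f0.
set m := f (0, 0) in f0.
have [rho0 rho0P] := finf (m / 2) (divr_gt0 f0 (ltr0Sn _ _)).
pose rho := Num.max rho0 1.
have rho_gt0 : 0 < rho by rewrite lt_max ltr01 orbT.
have rhoP x y : rho <= `|x| \/ rho <= `|y| -> f (x, y) < m / 2.
  move=> h; apply: rho0P; case: h => h; [left|right];
    by apply: le_trans h; rewrite le_max lexx.
(* On the square of half-side [rho] the quadratic term is at most [m / 4], so [g] stays below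
   [3 * m / 4] on the boundary, while its value at the origin is [m]. *)
pose eps := m / (8 * rho ^+ 2).
have eps_gt0 : 0 < eps by rewrite divr_gt0 // mulr_gt0 // exprn_gt0.
have epsE : eps * rho ^+ 2 = m / 8 by rewrite /eps; field; rewrite gt_eqF.
pose g (z : R * R) := f z + eps * (z.1 ^+ 2 + z.2 ^+ 2).
pose A : set (R * R) := `[- rho, rho] `*` `[- rho, rho].
have inA x y : (A (x, y)) <-> (`|x| <= rho /\ `|y| <= rho).
  by rewrite /A /= !in_itv /= -!ler_norml.
have gcont : continuous g.
  move=> z; apply: cvgD; first exact: fcont.
  apply: cvgM; first exact: cvg_cst.
  by apply: cvgD; rewrite !expr2; apply: cvgM;
    (exact: cvg_fst || exact: cvg_snd).
have [||| [x y] Axy gmax] := @compact_EVT_max _ R g A.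
- by exists (0, 0); apply/inA; rewrite normr0 ltW.
- by apply: compact_setX; exact: segment_compact.
- exact: continuous_subspaceT.
move: Axy; rewrite inE => /inA[xr yr].
have {}gmax u v : `|u| <= rho -> `|v| <= rho -> g (u, v) <= g (x, y).
  by move=> ur vr; apply: gmax; rewrite inE; apply/inA.
have gm : m <= g (x, y).
  have := gmax 0 0; rewrite /g /= !expr0n /= addr0 mulr0 addr0 normr0.
  by apply; exact: ltW.
have sqle u : `|u| <= rho -> u ^+ 2 <= rho ^+ 2.
  by move=> ur; rewrite -(real_normK (num_real u)) lerXn2r // nnegrE // ltW.
have gsmall u v :
    `|u| <= rho -> `|v| <= rho -> f (u, v) < m / 2 -> g (u, v) < m.
  move=> /sqle ur /sqle vr; rewrite /g /= => fuv.
  suff : eps * (u ^+ 2 + v ^+ 2) <= m / 8 + m / 8 by lra.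
  by rewrite -epsE -mulrDr ler_pM2l // lerD.
have xint : `|x| < rho.
  rewrite ltNge; apply/negP => h.
  have := gsmall _ _ xr yr (rhoP _ _ (or_introl h)); by rewrite ltNge gm.
have yint : `|y| < rho.
  rewrite ltNge; apply/negP => h.
  have := gsmall _ _ xr yr (rhoP _ _ (or_intror h)); by rewrite ltNge gm.
have [K K0 Kmean] := fmean x y.
set F := f (x, y) in Kmean *.
(* Below [d] one has [K * |F| * h < eps]; as [d <= 1], also [K * |F| * h ^+ 2 < eps], which
   contradicts the inequality [epsle] to be derived from maximality. *)
pose d := eps / (eps + K * `|F|).
have KF0 : 0 <= K * `|F| by rewrite mulr_ge0.
have den : 0 < eps + K * `|F| by rewrite ltr_wpDr.
have d0 : 0 < d by rewrite divr_gt0.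
pose h := Num.min (d / 2) (Num.min (rho - `|x|) (rho - `|y|)).
have h0 : 0 < h by rewrite !lt_min !subr_gt0 xint yint divr_gt0.
have hd : h < d.
  apply: (@le_lt_trans _ _ (d / 2)); first by rewrite ge_min lexx.
  by rewrite ltr_pdivrMr // ltr_pMr // ltr1n.
have hx : `|x| + h <= rho by rewrite -lerBrDl !ge_min lexx orbT.
have hy : `|y| + h <= rho by rewrite -lerBrDl !ge_min lexx !orbT.
have nh : `|h| = h by rewrite gtr0_norm.
have xp : `|x + h| <= rho.
  by apply: le_trans hx; apply: le_trans (ler_normD _ _) _; rewrite nh.
have xm : `|x - h| <= rho.
  by apply: le_trans hx; apply: le_trans (ler_normB _ _) _; rewrite nh.
have yp : `|y + h| <= rho.
  by apply: le_trans hy; apply: le_trans (ler_normD _ _) _; rewrite nh.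
have ym : `|y - h| <= rho.
  by apply: le_trans hy; apply: le_trans (ler_normB _ _) _; rewrite nh.
have := Kmean h.
set S := f (x + h, y) + _ + _ + _ => SF.
have Sle : S <= 4 * F - 4 * eps * h ^+ 2.
  have := gmax _ _ xp yr; have := gmax _ _ xm yr.
  have := gmax _ _ xr yp; have := gmax _ _ xr ym.
  rewrite /g /= -/F /S => g1 g2 g3 g4; clear -g1 g2 g3 g4; lra.
have Kh0 : 0 <= K * h ^+ 4 by rewrite mulr_ge0 // exprn_ge0 // ltW.
have {}SF : 4 * F <= (1 + K * h ^+ 4) * (4 * F - 4 * eps * h ^+ 2).
  by apply: le_trans SF _; rewrite ler_wpM2l // addr_ge0.
have h20 : 0 < h ^+ 2 by rewrite exprn_gt0.
have epsle : eps <= K * `|F| * h ^+ 2.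
  rewrite -(ler_pM2r h20).
  have FF : K * h ^+ 4 * F <= K * h ^+ 4 * `|F|.
    by rewrite ler_wpM2l // ler_norm.
  have : 0 <= K * h ^+ 4 * (eps * h ^+ 2).
    by rewrite (mulr_ge0 Kh0) // mulr_ge0 // ltW.
  have -> : K * `|F| * h ^+ 2 * h ^+ 2 = K * h ^+ 4 * `|F| by ring.
  move: SF FF; lra.
have d1 : d <= 1 by rewrite ler_pdivrMr // mul1r lerDl.
have h1 : h <= 1 by rewrite (le_trans (ltW hd)).
have : K * `|F| * h ^+ 2 <= K * `|F| * h.
  by rewrite ler_wpM2l // expr2 ler_piMr // ltW.
have : (eps + K * `|F|) * h < eps by rewrite mulrC -ltr_pdivlMr.
have : 0 < eps * h by rewrite mulr_gt0.
move: epsle; lra.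
Qed.

(** * Resolvents modulo the kernel of a seminorm *)

(* The kernel of [p] plays the role of a submodule that is factored out: [r l]
   inverts [l - a] modulo this kernel only. *)
Section ResolventSeminorm.
Context (R : realType) (M : lmodType R[i]) (p : M -> R) (a : M -> M) (Ka : R)
  (r : R[i] -> {linear M -> M}) (K : R[i] -> R).
Context (p_ge0 : forall x, 0 <= p x).
Context (pD : forall x y, p (x + y) <= p x + p y).
Context (pZ : forall c x, p (c *: x) = Normc.normc c * p x).
Context (pa : forall x, p (a x) <= Ka * p x).
Context (pr : forall l x, p (r l x) <= K l * p x).
Context (r_comm : forall l x, r l (a x) = a (r l x)).
Context (r_resolvent : forall l x, p (l *: r l x - a (r l x) - x) = 0).

Let pN x : p (- x) = p x.
Proof. by rewrite -scaleN1r pZ normcN Normc.normc1 mul1r. Qed.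

Let null0 x : p x <= 0 -> p x = 0.
Proof. by move=> px; apply/eqP; rewrite eq_le px p_ge0. Qed.

Let nullD x y : p x = 0 -> p y = 0 -> p (x + y) = 0.
Proof.
by move=> px py; apply: null0; rewrite (le_trans (pD _ _)) // px py addr0.
Qed.

Let nullB x y : p x = 0 -> p y = 0 -> p (x - y) = 0.
Proof. by move=> px py; apply: nullD => //; rewrite pN. Qed.

Let nullZ c x : p x = 0 -> p (c *: x) = 0.
Proof. by move=> px; rewrite pZ px mulr0. Qed.

Let nullr l x : p x = 0 -> p (r l x) = 0.
Proof. by move=> px; apply: null0; rewrite (le_trans (pr _ _)) // px mulr0. Qed.

Let le_null x y : p (x - y) = 0 -> p x <= p y.
Proof.
by move=> pxy; rewrite -[x](subrK y) (le_trans (pD _ _)) // pxy add0r.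
Qed.

(** Subtract [r l] applied to the resolvent equation of [x] at [m] from the resolvent equation of
    [r m x] at [l]; since [r l] commutes with [a], the terms in [a] cancel. *)
Lemma resolvent_identity l m x :
  p (r l x - r m x - (m - l) *: r l (r m x)) = 0.
Proof.
rewrite -(nullB (r_resolvent l (r m x)) (nullr l (r_resolvent m x))).
rewrite !linearB !linearZ r_comm /= scalerBl; congr p.
rewrite !(linearN,linearZ) /= !scalerN.
zmod.
Qed.

(* Adding the resolvents at [l + w] and [l - w] cancels the terms of odd order
   in [w]; doing so for [h] and [i h] then cancels those of order 2 in [h]. *)
Lemma null_pair l w x : let u := r (l + w) x + r (l - w) x in
  p (u - 2 *: r l x - w ^+ 2 *: r l (r l u)) = 0.
Proof.
move=> u; have := resolvent_identity l (l + w) x.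
have := resolvent_identity l (l - w) x.
rewrite [l + w - l]addrAC [l - w - l]addrAC !subrr !add0r scaleNr opprK.
rewrite {}/u; set y := r l x; set s := r (l + w) x; set t := r (l - w) x.
move=> Em Ep.
rewrite -(nullB (nullZ w (nullr l (nullB Ep Em))) (nullD Ep Em)); congr p.
have -> : 2 *: y = y + y by rewrite scaler_nat.
do 3 rewrite !(linearN, linearD) ?linearZ /=.
rewrite !(scalerDr, scalerN) !scalerA -expr2.
zmod.
Qed.

Lemma null_quadruple l h x :
  let v := r (l + h) x + r (l - h) x +
    (r (l + 'i%C * h) x + r (l - 'i%C * h) x) in
  p (v - 4 *: r l x - h ^+ 4 *: r l (r l (r l (r l v)))) = 0.
Proof.
have := null_pair l h x; have := null_pair l ('i%C * h) x => /=.
rewrite exprMn sqr_i mulN1r scaleNr opprK.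
set y := r l x; set s := r (l + h) x + _; set t := r (l + _) x + _.
pose q z := r l (r l z); rewrite -!/(q _) => Et Es.
(* Modulo the kernel, the difference of the two relations reads [s - t = h ^+ 2 *: q (s + t)].
   Substituting it into their sum, where [s - t] occurs as [h ^+ 2 *: q (s - t)], leaves only the
   term in [h ^+ 4]. *)
have qB := nullr l (nullr l (nullB Es Et)).
rewrite -(nullD (nullD Es Et) (nullZ (h ^+ 2) qB)).
rewrite -/(q _); congr p.
have -> : 4 *: y = 2 *: y + 2 *: y by rewrite -scalerDl -natrD.
have qD u w : q (u + w) = q u + q w by rewrite /q !linearD.
have qN u : q (- u) = - q u by rewrite /q !linearN.
have qZ c u : q (c *: u) = c *: q u by rewrite /q !linearZ.
rewrite !(qD, qN, qZ, scalerDr, scalerN) !scalerA -!exprD.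
zmod.
Qed.

(** Take seminorms in [null_quadruple]: the four factors [r l] cost [|K l| ^+ 4], and the error is a
    multiple of the sum over the neighbours, as [liouville_discrete] expects. *)
Lemma resolvent_mean l : exists2 C : R, 0 <= C & forall h x,
  4 * p (r l x) <= (1 + C * Normc.normc h ^+ 4) *
    (p (r (l + h) x) + p (r (l - h) x) +
     p (r (l + 'i%C * h) x) + p (r (l - 'i%C * h) x)).
Proof.
exists (`|K l| ^+ 4); first by rewrite exprn_ge0.
move=> h x.
have pr' z : p (r l z) <= `|K l| * p z.
  by rewrite (le_trans (pr _ _)) // ler_wpM2r // ler_norm.
have Kge0 : 0 <= `|K l| by [].
set v := r (l + h) x + r (l - h) x + (r (l + 'i%C * h) x + r (l - 'i%C * h) x).
have -> : 4 * p (r l x) = p (4 *: r l x).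
  by rewrite pZ normcMn Normc.normc1 -mulr_natl mulr1.
have pv : p v <= p (r (l + h) x) + p (r (l - h) x) +
     p (r (l + 'i%C * h) x) + p (r (l - 'i%C * h) x).
  by apply: le_trans (pD _ _) _; rewrite -addrA lerD.
apply: (@le_trans _ _ ((1 + `|K l| ^+ 4 * Normc.normc h ^+ 4) * p v));
  last first.
  by rewrite ler_wpM2l // addr_ge0 // mulr_ge0 // exprn_ge0 // normc_ge0.
have vle : p (r l (r l (r l (r l v)))) <= `|K l| ^+ 4 * p v.
  do 4 (apply: le_trans (pr' _) _; rewrite ?exprS -?mulrA ler_wpM2l //).
  by rewrite expr0 mul1r.
have E : p (4 *: r l x - (v - h ^+ 4 *: r l (r l (r l (r l v))))) = 0.
  by rewrite -pN opprB addrAC; exact: null_quadruple.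


apply: le_trans (le_null E) _; apply: le_trans (pD _ _) _.
rewrite pN pZ normcX mulrDl mul1r lerD //.
have -> : `|K l| ^+ 4 * Normc.normc h ^+ 4 * p v =
    Normc.normc h ^+ 4 * (`|K l| ^+ 4 * p v).
  by ring.
by rewrite ler_wpM2l // exprn_ge0 // normc_ge0.
Qed.

(** [K] enters only at the fixed point [l], as it carries no local bound; the factor [p (r m x)] at
    the moving point is absorbed later, when continuity is proved. *)
Lemma resolvent_lipschitz l m x :
 `| p (r l x) - p (r m x)| <= Normc.normc (m - l) * (`|K l| * p (r m x)).
Proof.
have E := resolvent_identity l m x.
have h1 : p (r l x - r m x) <= Normc.normc (m - l) * (`|K l| * p (r m x)).
  apply: le_trans (le_null E) _; rewrite pZ ler_wpM2l ?normc_ge0 //.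
  by rewrite (le_trans (pr _ _)) // ler_wpM2r // ler_norm.
have h2 : p (r m x - r l x) <= Normc.normc (m - l) * (`|K l| * p (r m x)).
  by rewrite -opprB pN.
rewrite ler_norml; apply/andP; split.
  rewrite lerNl opprB lerBlDr (le_trans _ (lerD h2 (lexx _))) //.
  by rewrite -{1}[r m x](subrK (r l x)).
rewrite lerBlDr (le_trans _ (lerD h1 (lexx _))) //.
by rewrite -{1}[r l x](subrK (r m x)).
Qed.

Lemma resolvent_decay x e : 0 < e -> exists2 C : R, 0 < C & forall l,
  C <= Normc.normc l -> p (r l x) < e.
Proof.
(* The resolvent equation gives [|l| * p (r l x) <= p x + |Ka| * p (r l x)]. If [p (r l x)] were at
   least [e], the first two summands would already account for the right-hand side, and the summand
   1 makes this a contradiction. *)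
move=> e0; exists (`|Ka| + p x / e + 1).
  by rewrite ltr_pwDr // addr_ge0 // divr_ge0 // ltW.
move=> l lC.
have E := r_resolvent l x.
have E' : p (l *: r l x - (x + a (r l x))) = 0 by rewrite -E; congr p; zmod.
have := le_trans (le_null E') (pD _ _).
have paK : p (a (r l x)) <= `|Ka| * p (r l x).
  by rewrite (le_trans (pa _)) // ler_wpM2r // ler_norm.
have h1 : (`|Ka| + p x / e + 1) * p (r l x) <= Normc.normc l * p (r l x).
  by rewrite ler_wpM2r.
rewrite pZ ltNge => h2; apply/negP => h3.
have h4 : p x <= p x / e * p (r l x).
  by rewrite mulrAC ler_pdivlMr // ler_wpM2l.
move: (lt_le_trans e0 h3) h1 h2 h4 paK; lra.
Qed.

(** The Liouville principle makes [r 0 x] null. The resolvent equation at 0 says that [x] equals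
    [- a (r 0 x)] modulo the kernel, and [a] preserves the kernel. *)
Lemma resolvent_seminorm_eq0 x : p x = 0.
Proof.
pose f (z : R * R) := p (r (z.1 +i* z.2)%C x).
have f0 : f (0, 0) <= 0.
  apply: liouville_discrete.
  - move=> [u v]; apply/cvgrPdist_lt => e e0.
    set l := (u +i* v)%C; set Kl := `|K l| + 1; set F := f (u, v) + 1.
    have Kl0 : 0 < Kl by rewrite ltr_pwDr.
    have F0 : 0 < F by rewrite ltr_pwDr // p_ge0.
    (* The first bound gives [d * Kl <= 1 / 2], whence [f (u', v') <= 2 * F]; the second then makes
       the Lipschitz estimate smaller than [e]. *)
    pose eta := Num.min ((2 * Kl)^-1) (e / (2 * Kl * F)).
    have eta0 : 0 < eta.
      by rewrite lt_min invr_gt0 divr_gt0 // !mulr_gt0.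
    have uv_near : \forall t \near (u, v), ball (u, v) (eta / 2) t.
      by apply: nbhsx_ballx; exact: divr_gt0.
    apply: filterS uv_near => -[u' v'] [/= bu bv].
    have := resolvent_lipschitz l (u' +i* v')%C x.
    set d := Normc.normc _; rewrite -/(f (u, v)) -/(f (u', v')).
    have d0 : 0 <= d by exact: normc_ge0.
    have dlt : d < eta.
      have -> : d = Normc.normc ((u' - u) +i* (v' - v))%C by [].
      apply: le_lt_trans (normc_le_normr _ _) _.
      by rewrite [ltRHS]splitr ltrD // distrC.
    have fv0 : 0 <= f (u', v') by exact: p_ge0.
    have f0 : 0 <= f (u, v) by exact: p_ge0.
    have dK : d * Kl <= 2^-1.
      have : d <= (2 * Kl)^-1 by rewrite (le_trans (ltW dlt)) // ge_min lexx.
      by rewrite invfM ler_pdivlMr.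
    have dKF : d * Kl * F < e / 2.
      have : d < e / (2 * Kl * F).
        by rewrite (lt_le_trans dlt) // ge_min lexx orbT.
      by rewrite ltr_pdivlMr ?mulr_gt0 // => le0; lra.
    have dKl0 : 0 <= d * Kl by rewrite mulr_ge0 // ltW.
    move=> le1.
    have le2 : d * (`|K l| * f (u', v')) <= d * Kl * f (u', v').
      by rewrite mulrA ler_wpM2r // ler_wpM2l // lerDl.
    have le3 : d * Kl * f (u', v') <= 2^-1 * f (u', v') by rewrite ler_wpM2r.
    have le4 : f (u', v') - f (u, v) <= `|f (u, v) - f (u', v')|.
      by rewrite distrC ler_norm.
    have le5 : d * Kl * f (u', v') <= d * Kl * (2 * F).
      rewrite ler_wpM2l // /F; lra.
    lra.
  - move=> e /(@resolvent_decay x)[C C0 CP]; exists C => u v uv.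
    apply: CP; apply: le_trans (normr_le_normc _ _).
    by rewrite le_max; case: uv => ->; rewrite ?orbT.
  (* For real [h], the shifts by [h] and ['i * h] move the first and the second coordinate. *)
  - move=> u v; have [C C0 CP] := resolvent_mean (u +i* v)%C; exists C => // h.
    have := CP (h%:C)%C x.
    have -> : Normc.normc h%:C%C ^+ 4 = h ^+ 4.
      rewrite /= expr0n addr0 sqrtr_sqr -[4%N]/(2 * 2)%N.
      by rewrite !exprM real_normK ?num_real.
    rewrite /f /=.
    by simpc.
have fx : p (r 0 x) = 0 by exact: null0.
have := r_resolvent 0 x; rewrite scale0r add0r -opprD pN => E.
have ax : p (a (r 0 x)) = 0.
  by apply: null0; rewrite (le_trans (pa _)) // fx mulr0.
by rewrite -[x](addKr (a (r 0 x))) addrC nullB.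
Qed.
End ResolventSeminorm.

(** * The contraction principle for complex-valued norms *)

Lemma contraction_fixpoint_complex (R : realType)
    (V : completeNormedModType R[i]) (f : V -> V) (k : R) :
  0 <= k < 1 -> (forall x y, `|f x - f y| <= (k%:C)%C * `|x - y|) ->
  exists x, f x = x.
Proof.
move=> /andP[k0 k1] fk.
pose y n := iter n f 0.
have [d d0 dE] := ge0_realc (normr_ge0 (f 0)).
have step n : `|y n.+1 - y n| <= ((k ^+ n * d)%:C)%C.
  elim: n => [|n IH]; first by rewrite /y /= subr0 dE expr0 mul1r.
  apply: le_trans (fk _ _) _; rewrite exprS -mulrA [leRHS]rmorphM /=.
  by rewrite ler_wpM2l // ler0c.
have k1' : 0 < 1 - k by rewrite subr_gt0.
pose C := d / (1 - k).
have C0 : 0 <= C by rewrite divr_ge0 // ltW.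
(* Keeping the exact partial geometric sum, with its factor [1 - k ^+ m], lets the induction close
   with an equality. *)
have dist n m : `|y n - y (n + m)%N| <= ((C * k ^+ n * (1 - k ^+ m))%:C)%C.
  elim: m => [|m IH]; first by rewrite addn0 expr0 !subrr normr0 mulr0.
  apply: le_trans (ler_distD (y (n + m)%N) _ _) _.
  rewrite addnS; apply: le_trans (lerD IH _) _.
    by rewrite distrC; exact: step.
  rewrite -rmorphD lecR /= le_eqVlt; apply/orP; left; apply/eqP.
  by rewrite exprD exprS /C; field; rewrite gt_eqF.
have dist' n m : (n <= m)%N -> `|y n - y m| <= ((C * k ^+ n)%:C)%C.
  move=> /subnKC <-; apply: le_trans (dist _ _) _.
  rewrite lecR ler_piMr ?(mulr_ge0 C0) ?exprn_ge0 //.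
  by rewrite gerBl exprn_ge0.
have small (e : R[i]) : 0 < e ->
    exists N, forall n, (N <= n)%N -> ((C * k ^+ n)%:C)%C < e.
  move=> /gt0_realc[e' e'0 ->].
  have : (fun n => C * k ^+ n) @ \oo --> (0 : R).
    by apply: cvg_geometric; rewrite ger0_norm.
  move=> /cvgrPdist_lt /(_ _ e'0)[N _ NP]; exists N => n /NP /=.
  by rewrite sub0r normrN ltcR ger0_norm // (mulr_ge0 C0) // exprn_ge0.
have /cvg_ex[x yx] : cvg (y @ \oo).
  apply/cauchy_cvgP/cauchy_exP => e /small[N NP]; exists (y N).
  exists N => // n /= Nn; rewrite -ball_normE /=.
  exact: le_lt_trans (dist' _ _ Nn) (NP _ (leqnn _)).
exists x; apply/eqP; rewrite -subr_eq0 -normr_le0.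
apply/ler_addgt0Pr => e e0; rewrite add0r.
have e2 : 0 < e / 2 by rewrite divr_gt0.
have [N _ NP] := (cvgrPdist_lt _ _).1 yx _ e2.
apply: le_trans (ler_distD (y N.+1) _ _) _.
rewrite [leRHS]splitr lerD //; last by rewrite distrC ltW // NP //= leqnSn.
apply: le_trans (fk _ _) _.
apply: (@le_trans _ _ `|x - y N|); last by rewrite ltW // NP /=.
by rewrite ler_piMl // (lecR _ 1) ltW.
Qed.

(** * Bounded bimodule operators and their quotient seminorm *)

Section IntertwiningOperators.
Context (R : realType) (E : banachAlgType R[i]) (a b : E).

(** These are the bounded endomorphisms of [E] as a bimodule, polynomials in [b] acting on the left
    and those in [a] on the right. As a predicate on functions, it lets the operators inherit the
    vector space structure of [E -> E]. *)
Definition bimodule_op_pred : {pred E -> E} := fun f =>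
  `[< [/\ linear f, exists C : R, forall x, `|f x| <= (C%:C)%C * `|x|,
          forall x, f (b * x) = b * f x & forall x, f (x * a) = f x * a] >].

Fact bimodule_op_submod_closed : submod_closed bimodule_op_pred.
Proof.
split=> [|c f g /asboolP[fL [Cf fC] fb fa] /asboolP[gL [Cg gC] gb ga]];
  apply/asboolP.
  split=> [k x y| |x|x] /=; rewrite ?scaler0 ?addr0 ?mulr0 ?mul0r //.
  by exists 0 => x; rewrite normr0 mul0r.
have [c' c'0 c'E] := ge0_realc (normr_ge0 c).
have fgE x : (c *: f + g) x = c *: f x + g x by [].
split=> [k x y| |x|x]; rewrite ?fgE.
- rewrite fL gL !scalerDr !scalerA [c * k]mulrC; zmod.
- exists (c' * Cf + Cg) => x; rewrite fgE; apply: le_trans (ler_normD _ _) _.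
  rewrite rmorphD mulrDl lerD // normrZ c'E rmorphM /= -mulrA ler_wpM2l //.
  by rewrite ler0c.
- by rewrite fb gb mulrDr scalerAr.
- by rewrite fa ga mulrDl scalerAl.
Qed.

HB.instance Definition _ :=
  GRing.isSubmodClosed.Build _ _ bimodule_op_pred bimodule_op_submod_closed.

Record bimodule_op := BimoduleOp {
  bimodule_fun :> E -> E;
  bimodule_funP : bimodule_fun \in bimodule_op_pred }.

HB.instance Definition _ := [isSub for bimodule_fun].
HB.instance Definition _ := [Choice of bimodule_op by <:].
HB.instance Definition _ := [SubChoice_isSubLmodule of bimodule_op by <:].

Notation M := bimodule_op.

Lemma bimodule_opP (f : M) :
  [/\ linear f, exists C : R, forall x, `|f x| <= (C%:C)%C * `|x|,
      forall x, f (b * x) = b * f x & forall x, f (x * a) = f x * a].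
Proof. by apply/asboolP; exact: bimodule_funP. Qed.

Fact bimodule_fun_linear (f : M) : linear f.
Proof. by have [] := bimodule_opP f. Qed.

HB.instance Definition _ (f : M) :=
  GRing.isLinear.Build R[i] E E _ f (bimodule_fun_linear f).

Lemma bimodule_op_bounded (f : M) :
  exists2 C : R, 0 <= C & forall x, `|f x| <= (C%:C)%C * `|x|.
Proof.
have [_ [C fC] _ _] := bimodule_opP f.
exists `|C| => // x; apply: le_trans (fC x) _.
by rewrite ler_wpM2r // lecR ler_norm.
Qed.

Lemma bimodule_opD (f g : M) x : (f + g) x = f x + g x. Proof. by []. Qed.
Lemma bimodule_opN (f : M) x : (- f) x = - f x. Proof. by []. Qed.
Lemma bimodule_opZ c (f : M) x : (c *: f) x = c *: f x. Proof. by []. Qed.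

Lemma bimodule_op_ext (f g : M) : f =1 g -> f = g.
Proof. by move=> fg; apply: val_inj; exact/funext. Qed.

Fact bimodule_comp_subproof (f g : M) : f \o g \in bimodule_op_pred.
Proof.
have [_ _ fb fa] := bimodule_opP f; have [_ _ gb ga] := bimodule_opP g.
have [Cf Cf0 fC] := bimodule_op_bounded f.
have [Cg Cg0 gC] := bimodule_op_bounded g.
apply/asboolP; split=> [k x y| |x|x] /=; rewrite ?linearP ?gb ?fb ?ga ?fa //.
exists (Cf * Cg) => x; apply: le_trans (fC _) _.
by rewrite rmorphM -mulrA ler_wpM2l // ler0c.
Qed.

Definition bimodule_comp f g := BimoduleOp (bimodule_comp_subproof f g).

Fact bimodule_comp_linear f : linear (bimodule_comp f).
Proof.
move=> c g h; apply: bimodule_op_ext => x.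
exact: (linearP f c (g x) (h x)).
Qed.

HB.instance Definition _ f :=
  GRing.isLinear.Build R[i] M M _ (bimodule_comp f) (bimodule_comp_linear f).

Fact bimodule_id_subproof : id \in bimodule_op_pred.
Proof. by apply/asboolP; split=> //; exists 1 => x; rewrite mul1r. Qed.

Definition bimodule_id := BimoduleOp bimodule_id_subproof.

Fact bimodule_lmul_subproof c : c * b = b * c -> *%R c \in bimodule_op_pred.
Proof.
move=> cb; apply/asboolP; split=> [k x y| |x|x].
- by rewrite mulrDr scalerAr.
- have [C _ CE] := ge0_realc (normr_ge0 c); exists C => x.
  by rewrite -CE; exact: banach_normM.
- by rewrite !mulrA cb.
- by rewrite mulrA.
Qed.

Definition bimodule_lmul c cb := BimoduleOp (@bimodule_lmul_subproof c cb).

Fact bimodule_rmul_subproof c : c * a = a * c -> *%R^~ c \in bimodule_op_pred.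
Proof.
move=> ca; apply/asboolP; split=> [k x y| |x|x].
- by rewrite mulrDl scalerAl.
- have [C _ CE] := ge0_realc (normr_ge0 c); exists C => x.
  by rewrite -CE mulrC; exact: banach_normM.
- by rewrite mulrA.
- by rewrite -!mulrA ca.
Qed.

Definition bimodule_rmul c ca := BimoduleOp (@bimodule_rmul_subproof c ca).

(** With T y = b y - y a, these constants bound [f] - T [d] in operator norm for some [d]. Their
    infimum [range_dist f] is the quotient seminorm modulo the operators T [d]. *)
Definition approx_by_range (f : M) : set R := [set k | 0 <= k /\
  exists d : M, forall x, `|f x - (b * d x - d x * a)| <= (k%:C)%C * `|x|].

Definition range_dist (f : M) : R := inf (approx_by_range f).

Let approx_lbound f : has_lbound (approx_by_range f).
Proof. by exists 0 => k []. Qed.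

Let approx_inf f : has_inf (approx_by_range f).
Proof.
split=> //; have [C C0 fC] := bimodule_op_bounded f.
exists C; split=> //; exists 0 => x.
by rewrite mulr0 mul0r subrr subr0.
Qed.

Lemma range_dist_le f k : approx_by_range f k -> range_dist f <= k.
Proof. exact: ge_inf. Qed.

Lemma range_dist_approx f e : 0 < e ->
  exists2 k, approx_by_range f k & k < range_dist f + e.
Proof. by move=> e0; exact: inf_adherent. Qed.

Lemma range_dist_ge0 f : 0 <= range_dist f.
Proof. by apply: lb_le_inf => [|k []//]; have [] := approx_inf f. Qed.

Lemma range_distD f g : range_dist (f + g) <= range_dist f + range_dist g.
Proof.
apply/ler_addgt0Pr => e e0; have e2 : 0 < e / 2 by rewrite divr_gt0.
have [k [k0 [d fd]] kf] := range_dist_approx f e2.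
have [l [l0 [d' gd]] lg] := range_dist_approx g e2.
apply: (@le_trans _ _ (k + l)); last by lra.
apply: range_dist_le; split; first exact: addr_ge0.
exists (d + d') => x.
have -> : (f + g) x - (b * (d + d') x - (d + d') x * a) =
    (f x - (b * d x - d x * a)) + (g x - (b * d' x - d' x * a)).
  by rewrite !bimodule_opD mulrDr mulrDl; zmod.
apply: le_trans (ler_normD _ _) _.
by rewrite rmorphD [leRHS]mulrDl; apply: lerD.
Qed.

Lemma range_dist_scale f g C : 0 <= C ->
  (forall k, approx_by_range f k -> approx_by_range g (C * k)) ->
  range_dist g <= C * range_dist f.
Proof.
move=> C0 fg; apply/ler_addgt0Pr => e e0.
(* Dividing [e] by [C + 1] instead of [C] covers the case [C = 0]. *)
have C1 : 0 < C + 1 by rewrite ltr_wpDl.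
have [k kf kle] := range_dist_approx f (divr_gt0 e0 C1).
apply: le_trans (range_dist_le (fg k kf)) _.
apply: le_trans (ler_wpM2l C0 (ltW kle)) _; rewrite mulrDr lerD2l.
by rewrite mulrA ler_pdivrMr // mulrC ler_pM2l // lerDl.
Qed.

Lemma range_distZ_le c f : range_dist (c *: f) <= Normc.normc c * range_dist f.
Proof.
apply: range_dist_scale => [|k [k0 [d fd]]]; first exact: normc_ge0.
split; first by rewrite mulr_ge0 // normc_ge0.
exists (c *: d) => x; rewrite !bimodule_opZ -scalerAr -scalerAl -!scalerBr.
by rewrite normrZ rmorphM -mulrA ler_wpM2l.
Qed.

Lemma range_distZ c f : range_dist (c *: f) = Normc.normc c * range_dist f.
Proof.
apply/eqP; rewrite eq_le range_distZ_le /=.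
have [->|c0] := eqVneq c 0.
  by rewrite Normc.normc0 mul0r range_dist_ge0.
have nc0 : 0 < Normc.normc c.
  rewrite lt_neqAle normc_ge0 andbT eq_sym.
  by apply: contra_neq c0 => /Normc.eq0_normc.
rewrite -ler_pdivlMl // -{1}[f](scalerK c0) -Normc.normcV.
exact: range_distZ_le.
Qed.

(** Since [f] commutes with T, it sends an approximation T [d] of [g] to T applied to the composite
    of [f] and [d]. *)
Lemma range_dist_comp f : exists C, forall g,
  range_dist (bimodule_comp f g) <= C * range_dist g.
Proof.
have [C C0 fC] := bimodule_op_bounded f; exists C => g.
have [_ _ fb fa] := bimodule_opP f.
apply: range_dist_scale => // k [k0 [d gd]]; split; first exact: mulr_ge0.
exists (bimodule_comp f d) => x /=; rewrite -fb -fa -!linearB rmorphM -mulrA.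
apply: le_trans (fC _) _.
by rewrite ler_wpM2l // ler0c.
Qed.

End IntertwiningOperators.


(** * Solving the Sylvester equation *)

Lemma range_dist_eq0 (R : realType) (E : banachAlgType R[i]) (a b : E) :
  (forall l, invertible (l%:A - b) \/ invertible (l%:A - a)) ->
  forall f : bimodule_op a b, range_dist f = 0.
Proof.
move=> inv_ab.
pose mulb : bimodule_op a b := bimodule_lmul a (erefl (b * b)).
have comm (c y : E) l :
    (l%:A - c) * y = 1 -> y * (l%:A - c) = 1 -> y * c = c * y.
  move=> ly yl; have : y * (l%:A - c) = (l%:A - c) * y by rewrite ly.
  by rewrite mulrBr mulrBl mulr_algl mulr_algr => /addrI/oppr_inj.
have /choice[r rP] l : exists u : bimodule_op a b, forall g,
    range_dist (l *: bimodule_comp u g -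
      bimodule_comp mulb (bimodule_comp u g) - g) = 0.
  have null f : approx_by_range f 0 -> range_dist f = 0.
    by move=> /range_dist_le f0; apply/eqP; rewrite eq_le f0 range_dist_ge0.
  have [[y [ly yl]]|[y [ly yl]]] := inv_ab l.
    (* Left multiplication by the inverse of [l - b] is an exact resolvent of [mulb], so [d = 0]
       serves. *)
    exists (bimodule_lmul a (comm _ _ _ ly yl)) => g; apply: null; split => //.
    exists 0 => x; rewrite mulr0 mul0r subrr subr0 mul0r.
    rewrite !(bimodule_opD, bimodule_opN, bimodule_opZ) /=.
    by rewrite scalerAl -mulr_algl -mulrA -mulrBl mulrA ly mul1r subrr normr0.
  exists (bimodule_rmul b (comm _ _ _ ly yl)) => g; apply: null; split => //.
  (* Right multiplication by the inverse [y] of [l - a] is a resolvent only modulo T: with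
     [z = g x * y] one has [g x = l *: z - z * a], so the defect is [z * a - b * z], that is T
     [(- z)]. *)
  exists (- bimodule_comp (bimodule_rmul b (comm _ _ _ ly yl)) g) => x.
  rewrite mul0r.
  rewrite !(bimodule_opD, bimodule_opN, bimodule_opZ) /=.
  set z := g x * y; have -> : g x = l *: z - z * a.
    by rewrite -[LHS]mulr1 -yl mulrBr mulr_algr mulrBr -scalerAr mulrA.
  rewrite mulrN mulNr (_ : _ - _ = 0) ?normr0 //; zmod.
have /choice[K KP] l : exists C, forall g : bimodule_op a b,
    range_dist (bimodule_comp (r l) g) <= C * range_dist g.
  exact: range_dist_comp.
have [Ka KaP] := range_dist_comp mulb.
apply: (@resolvent_seminorm_eq0 R _ (@range_dist R E a b)
  (bimodule_comp mulb) Ka (fun l => bimodule_comp (r l)) K) => //.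
- exact: range_dist_ge0.
- exact: range_distD.
- exact: range_distZ.
- move=> l f; apply: bimodule_op_ext => x /=.
  by have [_ _ -> _] := bimodule_opP (r l).
Qed.

Theorem sylvester_banach (R : realType) (E : banachAlgType R[i]) (a b q : E) :
  (forall l, invertible (l%:A - b) \/ invertible (l%:A - a)) ->
  exists! x : E, b * x - x * a = q.
Proof.
move=> /range_dist_eq0 /(_ (bimodule_id a b)) id0.
have [k [k0 [d dP]] k1] := range_dist_approx (bimodule_id a b) ltr01.
rewrite id0 add0r in k1.
pose T x := b * x - x * a.
have TB x y : T (x - y) = T x - T y by rewrite /T mulrBr mulrBl; zmod.
have Td x : T (d x) = d (T x).
  by have [_ _ db da] := bimodule_opP d; rewrite /T -db -da -linearB.
have dT x : `|x - T (d x)| <= (k%:C)%C * `|x| := dP x.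
(* A fixed point satisfies [T (d x) = q], so that [d x] solves the equation; the map contracts by
   [k < 1]. *)
have [x xP] : exists x, q + (x - T (d x)) = x.
  apply: (@contraction_fixpoint_complex _ _ _ k) => [|x y]; first by rewrite k0.
  rewrite (_ : _ - _ = (x - y) - T (d (x - y))) //.
  by rewrite (linearB d) TB; zmod.
exists (d x); split=> [|y Ty]; rewrite -/(T _).
  by apply: (addIr (x - T (d x))); rewrite xP addrC subrK.
apply/eqP; rewrite -subr_eq0 -normr_le0.
set z := d x - y.
have Tz : T z = 0.
  rewrite TB [T y]Ty; apply/eqP; rewrite subr_eq0; apply/eqP.
  by apply: (addIr (x - T (d x))); rewrite xP addrC subrK.
(* As [T (d z) = d (T z) = 0], this bound reads [|z| <= k * |z|] and forces [z = 0]. *)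
have := dT z; rewrite Td Tz linear0 subr0.
have [t t0 ->] := ge0_realc (normr_ge0 z); rewrite -rmorphM !lecR => ztk.
by rewrite -(pmulr_rle0 _ (_ : 0 < 1 - k)) ?subr_gt0 // mulrBl mul1r subr_le0.
Qed.

Theorem theorem2p1 (R : realType) (BB : banachAlgType R[i]) (S : pred BB)
    (AA : subBanachAlgType S) (A B Q : AA) :
  inverse_closed AA ->
  spectrum (\val A : BB) `&` spectrum (\val B : BB) = set0 ->
  exists! X : AA, B * X - X * A = Q.
Proof.
move=> invAA disj.
(* The equation is solved inside [AA] with its own norm; [BB] enters only through the invertibility
   of [l - B] or [l - A], which inverse-closedness brings back to [AA]. *)
apply: sylvester_banach => l.
have valE (a : AA) : l%:A - \val a = \val (l%:A - a).
  rewrite raddfB -[1 in LHS](rmorph1 (\val : AA -> BB)); congr (_ - _).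
  exact/esym/(@GRing.valZ _ _ _ AA l 1).
have [sB|sB] := EM (invertible (l%:A - \val B)); [left|right].
  by apply: invAA; rewrite -valE.
apply: invAA; rewrite -valE; apply: contrapT => sA.
have : (spectrum (\val A : BB) `&` spectrum (\val B : BB)) l by [].
by rewrite disj.
Qed.
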